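(* Let $k\in\mathbb{N}$ and let $\vec v=(v_n(x))_{n=0}^\infty\in V^\infty(A)$ be a sequence of variable words such that $v_n(x)$ is a left variable word for every $n\geq 1$. Let $r\geq 2$ and suppose that $[\vec v\parallel (A_{k+n})_{n=0}^\infty]_c=\bigcup_{i=1}^r E_i$. Then there exist $1\leq i\leq r$ and an infinite reduced $k$-block subsequence $\vec w=(w_n(x))_{n=0}^\infty$ of $\vec v$ such that $w_n(x)$ is a left variable word for every $n\geq 1$ and $[\vec w\parallel (A_{k+n})_{n=0}^\infty]_c\subseteq E_i$.
   Context: $\mathbb{N}=\{0,1,2,\dots\}$. Fix an increasing sequence $A_0\subseteq A_1\subseteq A_2\subseteq\cdots$ of nonempty finite sets (alphabets) and let $A=\bigcup_{n\in\mathbb{N}}A_n$. $W(A)$ is the set of all finite sequences (words) of elements of $A$, including the empty word; words are concatenated by juxtaposition. Fix a symbol $x\notin A$. A variable word is a finite word over $A\cup\{x\}$ in which $x$ occurs at least once; $V(A)$ is the set of variable words, and $V^\infty(A)$ is the set of infinite sequences of variable words. For $s(x)\in V(A)$ and $a\in A\cup\{x\}$, $s(a)$ is the word obtained by replacing every occurrence of $x$ in $s(x)$ by $a$. A left variable word is a variable word whose first letter is $x$. For a finite sequence $(s_n(x))_{n=p}^q$ of variable words and nonempty sets $B_p,\dots,B_q\subseteq A$, the reduced constant span is $[(s_n(x))_{n=p}^q\parallel(B_n)_{n=p}^q]_c=\{s_p(b_p)s_{p+1}(b_{p+1})\cdots s_q(b_q): b_n\in B_n \text{ for all } n\}$ and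 the reduced variable span is $[(s_n(x))_{n=p}^q\parallel(B_n)_{n=p}^q]_v=V(A)\cap\{s_p(b_p)\cdots s_q(b_q): b_n\in B_n\cup\{x\}\text{ for all }n\}$. For an infinite sequence $\vec s=(s_n(x))_{n=0}^\infty$ and sets $(B_n)_{n=0}^\infty$, $[\vec s\parallel(B_n)_{n=0}^\infty]_c=\bigcup_{m\in\mathbb{N}}[(s_n(x))_{n=0}^m\parallel(B_n)_{n=0}^m]_c$. For $k\in\mathbb{N}$ and $\vec s=(s_n(x))_{n=0}^\infty\in V^\infty(A)$, a finite sequence $(t_n(x))_{n=0}^l$ of variable words is a reduced $k$-block subsequence of $\vec s$ if there are integers $0=m_0<m_1<\dots<m_{l+1}$ with $t_i(x)\in[(s_n(x))_{n=m_i}^{m_{i+1}-1}\parallel(A_{k+n})_{n=m_i}^{m_{i+1}-1}]_v$ for all $0\leq i\leq l$; an infinite sequence in $V^\infty(A)$ is a reduced $k$-block subsequence of $\vec s$ if each of its finite initial segments is. *)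

(* Defs.v *)
From mathcomp Require Import all_boot.
From mathcomp Require Import classical_sets functions cardinality.

Set Implicit Arguments.
Unset Strict Implicit.
Unset Printing Implicit Defensive.

Local Open Scope classical_set_scope.

(* Letters of the ambient type [T] are represented by [Some a] and the variable
   symbol x, which must not belong to any alphabet, by [None]; both words over
   the alphabet and variable words are thus sequences over [option T]. *)
Definition word (T : choiceType) : Type := seq (option T).

Section Words.
Variable T : choiceType.
Implicit Types (A B : nat -> set T) (s t : nat -> word T).

(* V(A), for the alphabet A = \bigcup_n A n. *)
Definition variable_word A : set (word T) :=
  [set w | None \in w /\ forall a, Some a \in w -> (\bigcup_n A n) a].

Definition left_variable_word A : set (word T) :=
  [set w | variable_word A w /\ ohead w = Some None].

Definition variable_word_seq A : set (nat -> word T) :=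
  [set s | forall n, variable_word A (s n)].

(* w(c), where c is a letter or the variable. *)
Definition wsubst (w : word T) (c : option T) : word T :=
  [seq (if d is Some _ then d else c) | d <- w].

(* All words s_p(b_p) ... s_{q-1}(b_{q-1}) with b_n in C n; here and below the
   upper index q is excluded. *)
Definition span s (C : nat -> set (option T)) (p q : nat) : set (word T) :=
  [set w | exists b : nat -> option T,
     (forall n, p <= n < q -> C n (b n)) /\
     w = \big[cat/[::]]_(p <= n < q) wsubst (s n) (b n)].

Definition const_span s B (p q : nat) : set (word T) :=
  span s (fun n => Some @` B n) p q.

Definition var_span A s B (p q : nat) : set (word T) :=
  variable_word A `&` span s (fun n => Some @` B n `|` [set None]) p q.

Definition const_span_inf s B : set (word T) :=
  \bigcup_m const_span s B 0 m.+1.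

(* Only the terms t_0, ..., t_l of [t] and m_0, ..., m_{l+1} of [m] matter. *)
Definition fin_block_subseq A (k : nat) s (l : nat) t : Prop :=
  exists m : nat -> nat,
    [/\ m 0 = 0,
        forall i, i <= l -> m i < m i.+1 &
        forall i, i <= l ->
          var_span A s (fun n => A (k + n)) (m i) (m i.+1) (t i)].

Definition block_subseq A (k : nat) s t : Prop :=
  variable_word_seq A t /\ forall l, fin_block_subseq A k s l t.

End Words.

(* Main.v *)
(* Let B n = A (k + n).  The maximal left-invariant filters of constant words
   produce an ultrafilter U in a minimal closed left ideal, and the closed
   semigroup (left words) . U contains an idempotent ultrafilter V.  Write V(a)
   for the image of V under s |-> s(a).  Minimality of the ideal of U gives
   U . V(b) = U, hence V(a) . V(b) = V(a) for all letters a and b.  Thus if a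
   colour class E is V(a)-large, then so is the set of all words u in E such
   that u s(b) belongs to E for V-almost every s; this allows a greedy choice of
   left words s_0, s_1, ... with u s_0(b_0) ... s_l(b_l) of constant colour.
   Admissibility with respect to the growing alphabets B j is built into the
   words on which these filters live. *)

Require Import Defs.
From mathcomp Require Import all_boot.
From mathcomp Require Import boolp classical_sets functions cardinality.
From mathcomp Require Import filter.

Set Implicit Arguments.
Unset Strict Implicit.
Unset Printing Implicit Defensive.

Local Open Scope classical_set_scope.

(** * Maximal filters from Zorn's lemma *)

Section MaximalFilter.
Variables (X : Type) (Q : set_system X -> set X -> Prop).
Hypothesis Q_mono : forall F G E, ProperFilter F -> F `<=` G -> Q F E -> Q G E.

(** Monotonicity of [Q] in the filter lets the condition pass to unions of chains. It serves with
    [Q] expressing either containment in the own square or left invariance. *)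
Lemma maximal_filter (H : set_system X) : ProperFilter H ->
    (forall E, H E -> Q H E) ->
  exists F : set_system X, [/\ ProperFilter F, H `<=` F,
    forall E, F E -> Q F E &
    forall G, ProperFilter G -> (forall E, G E -> Q G E) -> F `<=` G ->
      G `<=` F].
Proof.
move=> H_proper HQ.
pose good F := [/\ ProperFilter F, H `<=` F & forall E, F E -> Q F E].
(* [set0] is added to the family because it is the union of the empty chain. *)
have [|A [[A0|[Aproper HA AQ]] Amax]] :=
    @Zorn_bigcup (set X) [set F | F = set0 \/ good F].
- move=> C Cgood Ctot.
  have [[F0 CF0 F0_neq0]|C0] :=
    pselect (exists2 F, C F & F <> set0); last first.
    left; apply/seteqP; split=> // E [F CF FE]; exfalso; apply: C0.
    by exists F => // F0; rewrite F0 in FE.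
  have inC F E : C F -> F E -> good F.
    by move=> CF FE; case: (Cgood _ CF) => // F_0; rewrite F_0 in FE.
  have [F0_proper HF0 _] : good F0 by case: (Cgood _ CF0).
  right; split.
  + apply: Build_ProperFilter_ex => [E [F CF FE]|].
      by have [? _ _] := inC _ _ CF FE; apply: filter_ex FE.
    split; first by exists F0 => //; exact: filterT.
    * move=> D E [F CF FD] [G CG GE].
      have [FG|GF] := Ctot _ _ CF CG.
        by have [? _ _] := inC _ _ CG GE; exists G => //; apply: filterI => //;
          exact: FG.
      by have [? _ _] := inC _ _ CF FD; exists F => //; apply: filterI => //;
        exact: GF.
    * move=> D E DE [F CF FD]; have [? _ _] := inC _ _ CF FD.
      by exists F => //; exact: filterS FD.
  + by move=> E HE; exists F0 => //; exact: HF0.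
  + move=> E [F CF FE]; have [? _ /(_ _ FE)] := inC _ _ CF FE.
    by apply: Q_mono => D FD; exists F.
- exfalso; apply: (Amax H); last by right; split.
  by rewrite A0; split=> // H0; exact: H0 (@filterT _ H _).
- exists A; split=> // G Gproper GQ AG; apply: contrapT => GA.
  by apply: (Amax G) => //; right; split=> //; exact: subset_trans AG.
Qed.

End MaximalFilter.

Lemma ultra_setC (X : Type) (V : set_system X) (E : set X) :
  UltraFilter V -> ~ V E -> V (~` E).
Proof. by move=> VU NE; case: (in_ultra_setVsetC E VU). Qed.

Lemma filter_finite (X Y : Type) (F : set_system X) (D : set Y)
    (P : Y -> set X) : Filter F -> finite_set D ->
  (forall y, D y -> F (P y)) -> F [set x | forall y, D y -> P y x].
Proof.
elim/Pchoice: Y => Y in D P * => FF /finite_fsetP[{}D ->] DP.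
by apply: filterS (filter_bigI FF DP) => x PDx y; exact: PDx.
Qed.

(** * Products of filters and idempotent ultrafilters *)

Section FilterProduct.
Variable X : Type.
Implicit Types (E : set (seq X)) (F G : set_system (seq X)) (u : seq X).

Definition lquot u E : set (seq X) := [set t | E (u ++ t)].

(* The extension of concatenation to filters, on ultrafilters the operation of
   the Stone-Cech compactification. *)
Definition fprod F G : set_system (seq X) :=
  [set E | F [set u | G (lquot u E)]].

Lemma lquot_cat u t E : lquot t (lquot u E) = lquot (u ++ t) E.
Proof. by rewrite /lquot; apply/funext => s /=; rewrite catA. Qed.

Lemma fprod_proper F G : ProperFilter F -> ProperFilter G ->
  ProperFilter (fprod F G).
Proof.
move=> FF GG; apply: Build_ProperFilter_ex => [E FGE|].
  have [u Gu] := @filter_ex _ F FF _ FGE.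
  by have [t Et] := @filter_ex _ G GG _ Gu; exists (u ++ t).
split.
- by apply: (@filterS _ F _ _ _ _ filterT) => u _; exact: filterT.
- move=> D E FD FE.
  apply: (@filterS _ F _ _ _ _ (@filterI _ F _ _ _ FD FE)) => u [].
  exact: filterI.
- move=> D E DE; apply: (@filterS _ F) => u; apply: filterS => t; exact: DE.
Qed.

Lemma fprodS F1 F2 G1 G2 : ProperFilter F1 -> F1 `<=` G1 -> F2 `<=` G2 ->
  fprod F1 F2 `<=` fprod G1 G2.
Proof.
move=> ? FG1 FG2 E FE; apply/FG1; apply: (@filterS _ F1 _ _ _ _ FE) => u.
exact: FG2.
Qed.

Lemma fprodA F1 F2 F3 : fprod F1 (fprod F2 F3) = fprod (fprod F1 F2) F3.
Proof.
rewrite /fprod; apply/funext => E /=; congr F1; apply/funext => u /=.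
by congr F2; apply/funext => t /=; rewrite lquot_cat.
Qed.

(* Ellis' lemma, in the form that a maximal filter contained in its own square
   is an ultrafilter. *)
Lemma idempotent_ultrafilter F : ProperFilter F -> F `<=` fprod F F ->
  exists V, [/\ UltraFilter V, F `<=` V & V `<=` fprod V V].
Proof.
move=> Fproper Fsq.
have [|//|V [Vproper FV V2 Vmax]] :=
  @maximal_filter _ (fun F E => fprod F F E) _ F Fproper.
  by move=> G K E GG GK; exact: fprodS.
have [p [pU Vp]] := ultraFilterLemma Vproper.
have VVp : V `<=` fprod V p by apply: subset_trans V2 _; exact: fprodS.
(* The product V . p is again contained in its own square and contains V, so maximality gives V . p
   = V. *)
have VpV : fprod V p `<=` V.
  apply: Vmax => //; first exact: fprod_proper.
  rewrite fprodA; apply: fprodS => //; apply: subset_trans V2 _.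
  exact: fprodS.
pose R E := [set u | p (lquot u E)].
have VR E : p E -> V (R E).
  (* An ultrafilter q contains [G] exactly when it contains V and q . p = p: this is the closed
     subsemigroup of left stabilisers of p in Ellis' argument. Maximality of V will force [G] into
     V. *)
  move=> pE; pose G := filter_from (V `*` p) (fun DE => DE.1 `&` R DE.2).
  have VG : V `<=` G.
    move=> D VD; exists (D, setT) => [|x []//].
    by split=> //; exact: filterT.
  have RG A : p A -> G (R A).
    move=> pA; exists (setT, A) => [|x []//].
    by split=> //; exact: filterT.
  have Gfilter : Filter G.
    apply: filter_from_filter.
      by exists (setT, setT); split; exact: filterT.
    move=> [D1 E1] [D2 E2] [/= VD1 pE1] [/= VD2 pE2].
    exists (D1 `&` D2, E1 `&` E2); first by split; exact: filterI.
    by move=> u [[D1u D2u]] /= pu; do ![split] => //;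
      apply: filterS pu => t [].
  have Gproper : ProperFilter G.
    apply: filter_from_proper => -[D A] [/= VD pA].
    apply: contrapT => DA0; apply: (filter_not_empty p).
    have -> : set0 = A `&` ~` A by rewrite setICr.
    apply: filterI => //; apply/Vp/VpV; apply: filterS VD => u Du.
    by apply: ultra_setC => pu; apply: DA0; exists u.
  suff Gsq B : G B -> fprod G G B by exact: (Vmax G _ Gsq VG _ (RG E pE)).
  move=> [[D A] [/= VD pA] DAB].
  have Dsq : fprod G G D by move: VD => /V2; exact: fprodS.
  have Asq : fprod G G (R A).
    apply: filterS (RG _ pA) => u pu.
    suff uA : lquot u (R A) = R (lquot u A) by rewrite /= uA; exact: RG.
    by apply/funext => t; rewrite /R /= lquot_cat.
  have GG : ProperFilter (fprod G G) by exact: fprod_proper.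
  exact: filterS DAB (filterI Dsq Asq).
have pV : p = V by apply/seteqP; split=> // E pE; apply/VpV/VR.
by exists V; split=> //; rewrite -pV.
Qed.

End FilterProduct.

(** * Admissible words, and ultrafilters on constant and left words *)

Section Words.
Variables (T : choiceType) (B : nat -> set T).
Hypotheses (B_neq0 : B 0 !=set0) (B_incr : forall n, B n `<=` B n.+1).
Implicit Types (w u s t d : word T) (E : set (word T)).

Lemma wsubst_cat s t c : wsubst (s ++ t) c = wsubst s c ++ wsubst t c.
Proof. exact: map_cat. Qed.

Lemma size_wsubst s c : size (wsubst s c) = size s.
Proof. exact: size_map. Qed.

Lemma wsubst_const w c : None \notin w -> wsubst w c = w.
Proof.
elim: w => //= -[a|] w IH; rewrite inE //= => w0.
by rewrite /wsubst /= -/(wsubst _ _) IH.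
Qed.

Lemma None_wsubst w a : None \notin wsubst w (Some a).
Proof. by elim: w => //= -[b|] w IH; rewrite inE. Qed.

Lemma wsubst_wsubst w c c' :
  wsubst (wsubst w c) c' = wsubst w (if c is Some _ then c else c').
Proof. by rewrite /wsubst -map_comp; apply: eq_map; case: c => [a|] [b|]. Qed.

Lemma letters_le m n : m <= n -> B m `<=` B n.
Proof. by move=> /subnK <-; elim: (n - m) => // j IH a /IH; exact: B_incr. Qed.

(* The default value of [nth] is the variable, which is always allowed. *)
Definition admissible w := forall j a, nth None w j = Some a -> B j a.

Definition const_word : set (word T) := [set w | admissible w /\ None \notin w].

Definition left_word : set (word T) :=
  [set w | admissible w /\ ohead w = Some None].

Lemma nth_wsubst s c j :
  nth None (wsubst s c) j =
  if j < size s then (if nth None s j is Some a then Some a else c) else None.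
Proof.
case: ltnP => js; last by rewrite nth_default // size_wsubst.
by rewrite /wsubst (nth_map None) //; case: nth.
Qed.

Lemma admissible_cat u t : admissible u -> admissible t -> admissible (u ++ t).
Proof.
move=> u_adm t_adm j a; rewrite nth_cat; case: ltnP => uj; first exact: u_adm.
by move/t_adm; apply: letters_le; exact: leq_subr.
Qed.

(** The prefix [u] shifts every position of [s] to at least [n], where the letter [a] is already
    allowed. *)
Lemma admissible_cat_wsubst n u s a : admissible u -> admissible s ->
  n <= size u -> B n a -> admissible (u ++ wsubst s (Some a)).
Proof.
move=> u_adm s_adm nu Ba j b; rewrite nth_cat; case: ltnP => uj.
  exact: u_adm.
rewrite nth_wsubst; case: ltnP => // js.
case sj: nth => [c|] [<-]; last by apply: letters_le Ba; exact: leq_trans uj.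
by apply: letters_le (s_adm _ _ sj); exact: leq_subr.
Qed.

Lemma const_word_cat u t : const_word u -> const_word t -> const_word (u ++ t).
Proof.
move=> [u_adm u0] [t_adm t0]; split; first exact: admissible_cat.
by rewrite mem_cat negb_or u0.
Qed.

Lemma const_word_cat_wsubst n u s a : const_word u -> admissible s ->
  n <= size u -> B n a -> const_word (u ++ wsubst s (Some a)).
Proof.
move=> [u_adm u0] s_adm nu Ba; split; first exact: admissible_cat_wsubst Ba.
by rewrite mem_cat negb_or u0 None_wsubst.
Qed.

Lemma left_word_cat s t : left_word s -> admissible t -> left_word (s ++ t).
Proof.
move=> [s_adm s_left] t_adm; split; first exact: admissible_cat.
by case: s s_left {s_adm}.
Qed.

Lemma const_word_nseq n : exists2 w, const_word w & size w = n.
Proof.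
have [a Ba] := B_neq0; exists (nseq n (Some a)); last by rewrite size_nseq.
split; first by move=> j b; rewrite nth_nseq; case: ifP => // _ [<-];
  exact: letters_le Ba.
by elim: n => //= n; rewrite inE.
Qed.

(* Maximal left-invariant filters are the minimal closed left ideals of the
   Stone-Cech compactification of the semigroup of constant words. *)
Lemma maximal_invariant_filter :
  exists M : set_system (word T), [/\ ProperFilter M, M const_word,
    forall n, M [set w | n <= size w],
    forall E u, M E -> const_word u -> M (lquot u E) &
    forall G, ProperFilter G -> M `<=` G ->
      (forall E u, G E -> const_word u -> G (lquot u E)) -> G `<=` M].
Proof.
(* Starting from the long constant words makes every extension concentrate on words long enough for
   any given letter to be allowed after them. *)
pose M0 := filter_from setT (fun n => [set w | const_word w /\ n <= size w]).
have M0_proper : ProperFilter M0.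
  apply: filter_from_proper.
    apply: filter_fromT_filter; first by exists 0.
    move=> m n; exists (maxn m n) => w [wc]; rewrite /= geq_max => /andP[mw nw].
    by [].
  by move=> n _; have [w wc <-] := const_word_nseq n; exists w.
have [||M [M_proper M0M M_inv Mmax]] :=
  @maximal_filter _ (fun F E => forall u, const_word u -> F (lquot u E)) _ M0
    M0_proper.
- by move=> F G E _ FG FE u uc; apply/FG/FE.
- move=> E [n _ nE] u uc; exists n => // w [wc nw]; apply: nE; split.
    exact: const_word_cat.
  by rewrite size_cat (leq_trans nw) // leq_addl.
exists M; split=> //.
- by apply: M0M; exists 0 => // w [].
- by move=> n; apply: M0M; exists n => // w [].
- by move=> E u ME uc; exact: M_inv.
- by move=> G GP MG G_inv; apply: Mmax => // E GE u; exact: G_inv.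
Qed.

(** For the images V(a), the last clause reads V(a) = V(a) . V(b), as an inclusion between
    ultrafilters. *)
Lemma left_ultrafilter : exists V : set_system (word T),
  [/\ UltraFilter V, V left_word &
    forall E m n a b, B m a -> B n b -> V [set s | E (wsubst s (Some a))] ->
      V [set s | V [set t | E (wsubst s (Some a) ++ wsubst t (Some b))]]].
Proof.
have [M [M_proper Mconst Msize M_inv Mmax]] := maximal_invariant_filter.
have [U [U_ultra MU]] := ultraFilterLemma M_proper.
(* [H] is the intersection of the ultrafilters s . U over left words s, so it stands for the closed
   set (left words) . U. *)
pose H : set_system (word T) :=
  [set E | forall s, left_word s -> U (lquot s E)].
have [a0 Ba0] := B_neq0.
have x_left : left_word [:: None] by split=> // -[|[|j]].
have H_proper : ProperFilter H.
  apply: Build_ProperFilter_ex => [E /(_ _ x_left) /filter_ex[t]|].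
    by exists ([:: None] ++ t).
  split; first by move=> s _; exact: filterT.
  - by move=> D E HD HE s s_left; apply: filterI; [exact: HD|exact: HE].
  - move=> D E DE HD s s_left.
    by apply: (@filterS _ U) (HD s s_left) => t; exact: DE.
(* U lives on constant words, and s t u is a left word when s and u are left words and t is
   constant. *)
have Hsq : H `<=` fprod H H.
  move=> E HE s s_left.
  apply: (@filterS _ U _ _ _ _ (MU _ Mconst)) => t [t_adm _].
  by move=> u [u_adm u_left]; rewrite lquot_cat; apply/HE/left_word_cat => //;
    exact: left_word_cat.
have [V [V_ultra HV Vsq]] := idempotent_ultrafilter H_proper Hsq.
exists V; split=> //.
  apply: HV => s s_left; apply: filterS (MU _ Mconst) => t [t_adm _].
  exact: left_word_cat.
pose Vsub a : set_system (word T) :=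
  [set E | V [set t | E (wsubst t (Some a))]].
have VsubI a D E : Vsub a D -> Vsub a E -> Vsub a (D `&` E).
  exact: filterI.
have Vsub_sq b E : Vsub b E -> Vsub b [set t | Vsub b (lquot t E)].
  move=> /Vsq; apply: (@filterS _ V) => s; apply: (@filterS _ V) => t.
  by rewrite /lquot /= wsubst_cat.
(* This is U . V(b) = U. The filter [G] below stands for the closed left ideal generated by U .
   V(b); it contains M, hence equals M by maximality. *)
have absorb n b E : B n b -> U E -> U [set w | Vsub b (lquot w E)].
  move=> Bb UE; apply: contrapT => NE.
  pose D := E `&` [set w | ~ Vsub b (lquot w E)].
  have UD : U D by apply: filterI => //; exact: ultra_setC.
  pose G : set_system (word T) := [set C | forall u, const_word u ->
    U [set w | Vsub b (lquot (u ++ w) C)]].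
  have MG : M `<=` G.
    move=> C MC u uc.
    apply: filterS (filterI (MU _ Mconst) (MU _ (Msize n))) => w [wc nw].
    have uws s : left_word s -> const_word (u ++ w ++ wsubst s (Some b)).
      move=> [s_adm _]; rewrite catA; apply: const_word_cat_wsubst Bb => //.
        exact: const_word_cat.
      by rewrite size_cat (leq_trans nw) // leq_addl.
    apply/HV => s s_left.
    have := MU _ (M_inv C _ MC (uws s s_left)).
    move=> /(filterI (MU _ Mconst)); apply: filterS => t [[_ t0]].
    by rewrite /lquot /= wsubst_cat (wsubst_const _ t0) -!catA.
  have G_proper : ProperFilter G.
    have e_const : const_word [::] by split=> // -[].
    apply: Build_ProperFilter_ex => [C /(_ _ e_const) /filter_ex[w]|].
      by move=> /(@filter_ex _ V)[t]; exists (w ++ wsubst t (Some b)).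
    split.
    + move=> u _; apply: (@filterS _ U _ _ _ _ filterT) => w _.
      by apply: (@filterS _ V _ _ _ _ filterT).
    + move=> C C' GC GC' u uc.
      apply: (@filterS _ U _ _ _ _ (@filterI _ U _ _ _ (GC u uc) (GC' u uc))).
      by move=> w []; exact: VsubI.
    + move=> C C' CC' GC u uc; apply: (@filterS _ U _ _ _ _ (GC u uc)) => w.
      by apply: filterS => t; exact: CC'.
  have GM : G `<=` M.
    apply: Mmax => // C u GC uc v vc.
    apply: filterS (GC _ (const_word_cat uc vc)) => w.
    by rewrite /= lquot_cat catA.
  (* Since D is U-large, its complement is not in [G], so some translate of D is V(b)-large.
     Idempotence of V(b) then yields a word of D that violates the definition of D. *)
  have [u [uc ND]] : exists u, const_word u /\
      ~ U [set w | Vsub b (lquot (u ++ w) (~` D))].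
    apply: contrapT => NGD; have /GM/MU UCD : G (~` D).
      by move=> u uc; apply: contrapT => uD; apply: NGD; exists u.
    apply: (filter_not_empty U).
    by rewrite -(setICr D); exact: filterI.
  have [w NwD] := filter_ex (ultra_setC U_ultra ND).
  have {NwD} wD : Vsub b (lquot (u ++ w) D).
    by apply: filterS (ultra_setC V_ultra NwD) => t /=; exact: contrapT.
  have wE : Vsub b (lquot (u ++ w) E) by apply: filterS wD => t [].
  have [t [[_ NtE]]] := filter_ex (VsubI _ _ _ wD (Vsub_sq _ _ wE)).
  by rewrite /= lquot_cat.
move=> E m n a b Ba Bb VE; apply: contrapT => /(ultra_setC V_ultra) NE.
pose F := [set s | E (wsubst s (Some a)) /\
                   ~ Vsub b (lquot (wsubst s (Some a)) E)].
have VF : V F by exact: filterI.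
(* By the definition of [H], F then meets s . U for some left word s. As (s w)(a) = s(a) w for
   constant w, the failure moves to U and contradicts [absorb]. *)
have : ~ H (~` F).
  move=> /HV VCF; apply: (filter_not_empty V); rewrite -(setICr F).
  exact: filterI.
apply=> s s_left; apply: contrapT => /(ultra_setC U_ultra) sF.
pose sE := lquot (wsubst s (Some a)) E.
have {sF} sF : U [set w | sE w /\ ~ Vsub b (lquot w sE)].
  apply: filterS (filterI (MU _ Mconst) sF) => w [[_ w0]] /contrapT [].
  by rewrite wsubst_cat (wsubst_const _ w0) /sE /= lquot_cat.
have sE_U : U sE by apply: filterS sF => w [].
have [w [[_ NwE] wE]] := filter_ex (filterI sF (absorb _ _ _ Bb sE_U)).
exact: NwE.
Qed.

(** At each stage the alphabets seen so far are finite, so only finitely many words have been built,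
    and V-almost every s extends all of them at once. *)
Lemma monochromatic_blocks (I : finType) (c : word T -> I) :
    (forall n, finite_set (B n)) ->
  exists i u (s : nat -> word T), [/\ const_word u, forall n, left_word (s n) &
    forall l (b : nat -> T), (forall n, n <= l -> B n (b n)) ->
      [set w | const_word w /\ c w = i]
        (u ++ \big[cat/[::]]_(0 <= n < l.+1) wsubst (s n) (Some (b n)))].
Proof.
move=> B_fin; have [V [V_ultra V_left V_sub]] := left_ultrafilter.
have [a0 Ba0] := B_neq0.
have [i Vi] : exists i, V [set s | c (wsubst s (Some a0)) = i].
  apply: contrapT => Nc.
  have : V [set s | forall i, c (wsubst s (Some a0)) <> i].
    apply: filter_forall => i; apply: ultra_setC => ci; apply: Nc.
    by exists i.
  by move=> /filter_ex[s /(_ (c (wsubst s (Some a0))))].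
pose E := [set w | const_word w /\ c w = i].
have VE : V [set s | E (wsubst s (Some a0))].
  apply: filterS (filterI V_left Vi) => s [[s_adm _] cs]; split=> //.
  apply: (@const_word_cat_wsubst 0 [::]) => //.
  by split=> // -[].
(* The invariant of the greedy choice: almost every next block keeps the colour, for each letter of
   the current alphabet. *)
pose good n u := [/\ const_word u, n <= size u &
  forall b, B n b -> V [set t | E (u ++ wsubst t (Some b))]].
have [s0 [us0 Vs0]] : exists s0, E (wsubst s0 (Some a0)) /\
    forall b, B 0 b -> V [set t | E (wsubst s0 (Some a0) ++ wsubst t (Some b))].
  apply: (@filter_ex _ V); apply: filterI => //.
  by apply: filter_finite => // b Bb; apply: V_sub Ba0 Bb VE.
pose u := wsubst s0 (Some a0).
(* Stated for all pairs, with a dummy block when the hypotheses fail, so that [choice] gives a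
   function to iterate. *)
have next (nP : nat * set (word T)) : exists s, finite_set nP.2 ->
    (forall u, nP.2 u -> good nP.1 u) -> left_word s /\
    forall u, nP.2 u -> forall a, B nP.1 a ->
      E (u ++ wsubst s (Some a)) /\ good nP.1.+1 (u ++ wsubst s (Some a)).
  case: nP => n P /=.
  have [[P_fin P_good]|NP] :=
    pselect (finite_set P /\ forall u, P u -> good n u);
    last by exists [::] => P_fin P_good; case: NP.
  suff [s [s_left sP]] : exists s, left_word s /\ forall u, P u ->
      forall a, B n a -> E (u ++ wsubst s (Some a)) /\
        forall b, B n.+1 b -> V [set t |
          lquot u E (wsubst s (Some a) ++ wsubst t (Some b))].
    exists s => _ _; split=> // w Pw a Ba; have [Ew Vw] := sP _ Pw _ Ba.
    split=> //; split; first by case: Ew.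
      have [_ nw _] := P_good _ Pw; rewrite size_cat size_wsubst.
      rewrite -addn1 leq_add //.
      by case: s_left => _; case: (s).
    move=> b /Vw; apply: filterS => t.
    by rewrite /lquot /= catA.
  apply: (@filter_ex _ V); apply: filterI => //.
  apply: filter_finite => // w Pw; apply: filter_finite => // a Ba.
  have [_ _ Vw] := P_good _ Pw.
  apply: filterI; first exact: Vw.
  apply: filter_finite => // b Bb.
  exact: (V_sub (lquot w E) _ _ _ _ Ba Bb (Vw _ Ba)).
have [f fP] := choice next.
(* [P n] is the set of all words u s_0(b_0) ... s_{n-1}(b_{n-1}) with b_j in B j. *)
pose P := fix P n := if n is n'.+1 then
  [set w ++ wsubst (f (n', P n')) (Some a) | w in P n' & a in B n']
  else [set u].
have P_good n : finite_set (P n) /\ forall w, P n w -> good n w.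
  elim: n => [|n [P_fin PG]] /=.
    by split; [exact: finite_set1|move=> _ ->; split=> //; case: us0].
  split; first exact: finite_image2.
  move=> _ [w Pw [a Ba <-]].
  by have [_ /(_ _ Pw _ Ba)[]] := fP (n, P n) P_fin PG.
pose s n := f (n, P n).
have sP n := fP (n, P n) (P_good n).1 (P_good n).2.
exists i, u, s; split.
- by case: us0.
- by move=> n; case: (sP n).
- move=> l b Bb; rewrite big_nat_recr //= catA.
  have [_ sPl] := sP l; apply: (sPl _ _ _ (Bb l (leqnn l))).1.
  elim: l Bb {sPl} => [|l IH] Bb; first by rewrite big_nil cats0.
  rewrite big_nat_recr //= catA.
  exists (u ++ \big[cat/[::]]_(0 <= n < l) wsubst (s n) (Some (b n))).
    by apply: IH => n nl; apply: Bb; exact: leqW.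
  by exists (b l) => //; exact: Bb.
Qed.

End Words.

(** * Words as codes for elements of the spans of v *)

Section Expand.
Variables (T : choiceType) (v : nat -> word T).
Implicit Types d : word T.

(** The letters of [d] are the values substituted into v_m, v_{m+1}, and so on. For m = 0,
    admissibility of [d] is exactly the alphabet restriction in the reduced spans. *)
Fixpoint expand m d : word T :=
  if d is c :: d' then wsubst (v m) c ++ expand m.+1 d' else [::].

Lemma expand_cat m d1 d2 :
  expand m (d1 ++ d2) = expand m d1 ++ expand (m + size d1) d2.
Proof.
elim: d1 m => [|c d1 IH] m /=; first by rewrite addn0.
by rewrite IH addSnnS catA.
Qed.

Lemma wsubst_expand m d c : wsubst (expand m d) c = expand m (wsubst d c).
Proof. by elim: d m => //= c' d IH m; rewrite wsubst_cat wsubst_wsubst IH. Qed.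

Lemma expandE m d :
  expand m d =
  \big[cat/[::]]_(m <= n < m + size d) wsubst (v n) (nth None d (n - m)).
Proof.
elim: d m => [|c d IH] m /=; first by rewrite addn0 big_geq.
rewrite big_ltn ?addnS ?ltnS ?leq_addr // subnn IH addSn; congr (_ ++ _).
by apply: eq_big_nat => n /andP[mn _]; rewrite -(subnSK mn).
Qed.

Lemma expand_big (e : nat -> word T) l :
  expand 0 (\big[cat/[::]]_(0 <= i < l) e i) =
  \big[cat/[::]]_(0 <= i < l) expand (\sum_(0 <= j < i) size (e j)) (e i).
Proof.
have size_big k : size (\big[cat/[::]]_(0 <= i < k) e i) =
    \sum_(0 <= j < k) size (e j).
  elim: k => [|k IH]; first by rewrite !big_nil.
  by rewrite !big_nat_recr //= size_cat IH.
elim: l => [|l IH]; first by rewrite !big_nil.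
by rewrite !big_nat_recr //= expand_cat IH size_big.
Qed.

Lemma expand_letters (S : set (option T)) m d :
    (forall n c, c \in v n -> S c) -> (forall c, c \in d -> S c) ->
  forall c, c \in expand m d -> S c.
Proof.
move=> vS; elim: d m => //= c' d IH m dS c.
rewrite mem_cat => /orP[|]; last first.
  by apply: IH => c1 c1d; apply: dS; rewrite inE c1d orbT.
move=> /mapP[[a|] av ->]; first exact: vS av.
by apply: dS; rewrite inE eqxx.
Qed.

Lemma wsubst_None (w : word T) : wsubst w None = w.
Proof. by rewrite /wsubst map_id_in // => -[]. Qed.

Lemma None_expand m d : (forall n, None \in v n) -> None \in d ->
  None \in expand m d.
Proof.
move=> v0; elim: d m => //= c d IH m; rewrite inE mem_cat => /orP[/eqP <-|d0].
  by rewrite wsubst_None v0.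
by rewrite IH // orbT.
Qed.

End Expand.

(** * Transfer of the monochromatic blocks to the sequence v *)

Theorem theorem22 (T : choiceType) (A : nat -> set T)
    (A_neq0 : forall n, A n !=set0)
    (A_fin : forall n, finite_set (A n))
    (A_incr : forall n, A n `<=` A n.+1)
    (k : nat) (v : nat -> word T)
    (v_var : variable_word_seq A v)
    (v_left : forall n, 1 <= n -> left_variable_word A (v n))
    (r : nat) (r_ge2 : 2 <= r) (E : 'I_r -> set (word T))
    (E_cover : const_span_inf v (fun n => A (k + n)) = \bigcup_i E i) :
  exists (i : 'I_r) (w : nat -> word T),
    [/\ block_subseq A k v w,
        forall n, 1 <= n -> left_variable_word A (w n) &
        const_span_inf w (fun n => A (k + n)) `<=` E i].
Proof.
pose B n := A (k + n).
have B_incr n : B n `<=` B n.+1 by rewrite /B addnS; exact: A_incr.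
have A_B n a : B n a -> (\bigcup_n A n) a by exists (k + n).
have const_span_expand d : const_word B d -> d <> [::] ->
    const_span_inf v B (expand v 0 d).
  move=> [d_adm d0] d_neq0; exists (size d).-1 => //.
  have d_gt0 : 0 < size d by case: (d) d_neq0.
  rewrite prednK //; exists (nth None d); split.
    move=> n /andP[_ nd]; case dn: nth => [a|].
      by exists a => //; exact: d_adm.
    by move: d0; rewrite -dn mem_nth.
  by rewrite expandE; apply: eq_big_nat => n _; rewrite subn0.
(* Words are coloured through their expansions, with an arbitrary colour outside the span. *)
have colour d :
    exists i, const_span_inf v B (expand v 0 d) -> E i (expand v 0 d).
  have [vd|Nvd] := pselect (const_span_inf v B (expand v 0 d)).
    by move: vd; rewrite E_cover => -[i _ Ei]; exists i.
  by exists (Ordinal (ltnW r_ge2)).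
have [c cE] := choice colour.
have [i [u [s [u_const s_left sE]]]] :=
  monochromatic_blocks (A_neq0 _) B_incr c (fun n => A_fin (k + n)).
(* The constant prefix [u] is absorbed into the first block, the only one that may fail to be a left
   word; [m n] is where block n starts. *)
pose d n := if n is 0 then u ++ s 0 else s n.
pose m n := \sum_(0 <= j < n) size (d j).
pose w n := expand v (m n) (d n).
have d_adm n : admissible B (d n).
  case: n => [|n]; last by case: (s_left n.+1).
  by apply: admissible_cat => //; [case: u_const|case: (s_left 0)].
have d0 n : None \in d n.
  suff s0 : None \in s n by case: n s0 => [|n] //= s0; rewrite mem_cat s0 orbT.
  by have [_] := s_left n; case: (s n) => //= _ l [->]; rewrite inE eqxx.
have mS n : m n.+1 = m n + size (d n) by rewrite /m big_nat_recr.
have m_lt n : m n < m n.+1.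
  by rewrite mS -[X in X < _]addn0 ltn_add2l; case: (d n) (d0 n).
have w_var n : variable_word A (w n).
  split; first by apply: None_expand (d0 n) => j; case: (v_var j).
  move=> a aw; pose S c := if c is Some a then (\bigcup_n A n) a else True.
  apply: (@expand_letters _ v S (m n) (d n) _ _ (Some a) aw).
    by move=> j [b|] // bv; case: (v_var j) => _; exact.
  move=> [b|] // /(nthP None)[j jd djb].
  exact: A_B (d_adm _ _ _ djb).
exists i, w; split.
- split=> // l; exists m; split=> [|j _|j _];
    [by rewrite /m big_nil|exact: m_lt|].
  split=> //; exists (fun n => nth None (d j) (n - m j)); split; last first.
    by rewrite mS -expandE.
  move=> n _; case djn: nth => [a|]; last by right.
  (* Admissibility is counted from the start of the block, giving B (n - m j), which lies in B n. *)
  left; exists a => //; apply: letters_le (d_adm _ _ _ djn) => //.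
  exact: leq_subr.
- move=> [//|n] _; split=> //.
  (* A later block starts at a positive index, so both the term of v there and the first letter
     substituted into it begin with x. *)
  have m_gt0 : 0 < m n.+1 by exact: leq_ltn_trans (m_lt n).
  rewrite /w /=; have [_] := s_left n.+1; case: (s n.+1) => //= _ s' [->] /=.
  by rewrite wsubst_None; have [_] := v_left _ m_gt0; case: (v _).
- move=> _ [l _ [b [Bb ->]]].
  have [a0 Ba0] := A_neq0 (k + 0).
  (* The filler [a0] can occur only at indices beyond l. *)
  pose b' n := if b n is Some a then a else a0.
  have b'E n : n <= l -> B n (b' n) /\ b n = Some (b' n).
    by move=> nl; have [//|a Ba ab] := Bb n; rewrite /b' -ab.
  have [|D_const cD] := sE l b'; first by move=> n /b'E[].
  set D := u ++ _ in D_const cD.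
  have -> : \big[cat/[::]]_(0 <= n < l.+1) wsubst (w n) (b n) = expand v 0 D.
    have -> : D = \big[cat/[::]]_(0 <= n < l.+1) wsubst (d n) (Some (b' n)).
      rewrite /D !big_nat_recl //= wsubst_cat catA (@wsubst_const _ u) //.
      by case: u_const.
    rewrite expand_big; apply: eq_big_nat => n /andP[_ /b'E[_ ->]].
    rewrite /w wsubst_expand; congr expand.
    by apply: eq_bigr => j _; rewrite size_wsubst.
  rewrite -cD; apply/cE/const_span_expand => //.
  rewrite /D big_nat_recl // => /(congr1 size); rewrite !size_cat size_wsubst.
  by have [_] := s_left 0; case: (s 0) => //= _ s' _; rewrite addSn addnS.
Qed.
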